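(* Let $b$ be a prime, let $m,d\in\mathbb{N}$ with $m\ge 4$, let $p\in\mathbb{F}_b[x]$ be irreducible with $\deg(p)=m$, and let $\boldsymbol{\eta}=(\eta_{\mathfrak{u}})_{\mathfrak{u}\subseteq\{1,\ldots,d\}}$ be positive weights. Let $\boldsymbol{g}=(g_1,\ldots,g_d)\in(G^*_{b,m})^d$ be a generating vector constructed by Algorithm 1 (described in the context) with modulus $p$ and weights $\boldsymbol{\eta}$. Then $$T_{\boldsymbol{\eta}}(\boldsymbol{g},p)\le\frac{1}{b^m}\sum_{\emptyset\ne\mathfrak{u}\subseteq\{1,\ldots,d\}}\eta_{\mathfrak{u}}\left(2\,((b-1)m)^{|\mathfrak{u}|}+b\,m\left(2(b-1)m+\frac{2b}{b-1}\right)^{|\mathfrak{u}|}\right).$$ Moreover, if $\boldsymbol{\eta}=(\eta_{\mathfrak{u}})$ is a family of positive weights indexed by all finite subsets $\mathfrak{u}\subset\mathbb{N}$ (restricted to subsets of $\{1,\ldots,d\}$ when the dimension is $d$) that satisfies $$\sum_{j\ge1}\ \max_{\mathfrak{v}\subseteq\{1,\ldots,j-1\}}\frac{\eta_{\mathfrak{v}\cup\{j\}}}{\eta_{\mathfrak{v}}}<\infty,$$ then $T_{\boldsymbol{\eta}}(\boldsymbol{g},p)$ can be bounded independently of the dimension $d$; that is, there is a finite constant $C$, not depending on $d$, such that for every $d\in\mathbb{N}$ the vector $\boldsymbol{g}\in(G^*_{b,m})^d$ constructed by Algorithm 1 satisfies $T_{\boldsymbol{\eta}}(\boldsymbol{g},p)\le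 C$.
   Context: $\mathbb{F}_b$ is the field with $b$ elements ($b$ prime), identified with $\{0,1,\ldots,b-1\}$. $G^*_{b,m}:=\{g\in\mathbb{F}_b[x]\setminus\{0\}:\deg(g)<m\}$. An integer $n\in\mathbb{N}_0$ with base-$b$ expansion $n=n_0+n_1b+\cdots+n_ab^a$ is associated with the polynomial $n(x)=\sum_{k=0}^a n_kx^k\in\mathbb{F}_b[x]$. The map $v_m$ from the formal Laurent series field $\mathbb{F}_b((x^{-1}))$ to $[0,1)$ is $v_m\left(\sum_{\ell=w}^\infty t_\ell x^{-\ell}\right)=\sum_{\ell=\max(1,w)}^m t_\ell b^{-\ell}$; for vectors it is applied component-wise. Rational functions such as $n(x)g(x)/p(x)$ are regarded as elements of $\mathbb{F}_b((x^{-1}))$. For $k\in\mathbb{N}_0$ with base-$b$ digits $\kappa_0,\kappa_1,\ldots$, $\mathrm{tr}_m(k):=\kappa_0+\kappa_1x+\cdots+\kappa_{m-1}x^{m-1}\in\mathbb{F}_b[x]$, applied component-wise to vectors $\boldsymbol{k}$; $\mathrm{tr}_m(\boldsymbol{k})\cdot\boldsymbol{g}:=\sum_{j=1}^d\mathrm{tr}_m(k_j)g_j$. For $\boldsymbol{k}\in\mathbb{N}_0^d$ let $\mathrm{supp}(\boldsymbol{k})=\{j:k_j\ne0\}$ and $$r_{1,\boldsymbol{\eta}}(\boldsymbol{k}):=\eta_{\mathrm{supp}(\boldsymbol{k})}^{-1}\prod_{j\in\mathrm{supp}(\boldsymbol{k})}b^{\lfloor\log_b(k_j)\rfloor}.$$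 The quality measure is $$T_{\boldsymbol{\eta}}(\boldsymbol{g},p):=\sum_{\boldsymbol{0}\ne\boldsymbol{k}\in A_p(\boldsymbol{g})}\frac{1}{r_{1,\boldsymbol{\eta}}(\boldsymbol{k})},\qquad A_p(\boldsymbol{g}):=\{\boldsymbol{k}\in\{0,1,\ldots,b^m-1\}^d:\mathrm{tr}_m(\boldsymbol{k})\cdot\boldsymbol{g}\equiv0\ (\mathrm{mod}\ p)\}.$$ For $\emptyset\ne\mathfrak{u}\subseteq\{1,\ldots,d\}$ let $L_{\mathfrak{u}}(\boldsymbol{x}_{\mathfrak{u}}):=\prod_{j\in\mathfrak{u}}\left((1-b)\lfloor\log_b(x_j)\rfloor-b\right)$ for $\boldsymbol{x}_{\mathfrak{u}}=(x_j)_{j\in\mathfrak{u}}\in(0,1]^{|\mathfrak{u}|}$. For $s\in\{1,\ldots,d\}$ and $(g_1,\ldots,g_s)\in(G^*_{b,m})^s$ define $$K_{b^m,s,\boldsymbol{\eta}}(g_1,\ldots,g_s):=\sum_{\emptyset\ne\mathfrak{u}\subseteq\{1,\ldots,s\}}\eta_{\mathfrak{u}}\sum_{n=1}^{b^m-1}L_{\mathfrak{u}}\left(v_m\left(\frac{n(x)\,\boldsymbol{g}_{\mathfrak{u}}(x)}{p(x)}\right)\right),\qquad\boldsymbol{g}_{\mathfrak{u}}=(g_j)_{j\in\mathfrak{u}}.$$ Algorithm 1 (component-by-component construction), with inputs $b,m,d$, weights $\boldsymbol{\eta}$ and irreducible modulus $p$ of degree $m$: set $g_1=1$; for $s=2,\ldots,d$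 let $g_s\in G^*_{b,m}$ be a minimizer of $g\mapsto K_{b^m,s,\boldsymbol{\eta}}(g_1,\ldots,g_{s-1},g)$ over $g\in G^*_{b,m}$. Output $\boldsymbol{g}=(g_1,\ldots,g_d)$. *)

(* Defs.v *)
From HB Require Import structures.
From mathcomp Require Import all_boot all_order all_algebra.
From mathcomp Require Import finmap.
From mathcomp Require Import all_classical all_reals all_analysis.

Set Implicit Arguments.
Unset Strict Implicit.
Unset Printing Implicit Defensive.

Import Order.TTheory GRing.Theory Num.Theory.

Local Open Scope ring_scope.

(* Formal Laurent series in x^-1: [lcoef t l] is the coefficient of x^(-l). *)
Record laurent (F : fieldType) := Laurent {
  lcoef :> int -> F;
  lcoef_bounded : exists w : int, forall l : int, l < w -> lcoef l = 0
}.

(* Coefficient of x^(-l) in the polynomial q. *)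
Definition poly_lcoef (F : fieldType) (q : {poly F}) (l : int) : F :=
  match l with
  | Posz 0 => q`_0
  | Posz _.+1 => 0
  | Negz k => q`_k.+1
  end.

(* Coefficient of x^(-l) in q / p. For l >= 0 it is the constant coefficient
   of x^l q / p, whose polynomial part is the Euclidean quotient. *)
Definition frac_lcoef (F : fieldType) (q p : {poly F}) (l : int) : F :=
  match l with
  | Posz k => ((q * 'X^k) %/ p)`_0
  | Negz k => (q %/ p)`_k.+1
  end.

Lemma frac_lcoef_bounded (F : fieldType) (q p : {poly F}) :
  exists w : int, forall l : int, l < w -> frac_lcoef q p l = 0.
Proof.
exists (- (size q)%:Z) => -[k|k] /= lt_l.
  by have := lt_le_trans lt_l (_ : - (size q)%:Z <= 0); rewrite oppr_le0 => /(_ isT).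
move: lt_l; rewrite NegzE ltrN2 ltz_nat => lt_qk.
apply: nth_default; apply: leq_trans (ltnW lt_qk).
exact: leq_divp.
Qed.

Definition laurent_frac (F : fieldType) (q p : {poly F}) : laurent F :=
  Laurent (frac_lcoef_bounded q p).

Lemma coef_divp_mulXn (F : fieldType) (r p : {poly F}) (a i : nat) :
  p != 0 -> ((r * 'X^a) %/ p)`_(a + i) = (r %/ p)`_i.
Proof.
move=> p0; rewrite {1}(divp_eq r p) mulrDl divpD coefD mulrAC mulpK //.
rewrite coefMXn ltnNge leq_addr /= addKn [X in _ + X]nth_default ?addr0 //.
rewrite size_divp //; have := ltn_modp r p; rewrite p0 => lt_rp.
apply: leq_trans (leq_addr i a); rewrite leq_subLR.
have [->|r0] := eqVneq (r %% p) 0; first by rewrite mul0r size_poly0.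
rewrite size_mul ?expf_neq0 ?polyX_eq0 // size_polyXn addnS /= leq_add2r.
by rewrite -ltnS prednK // (leq_ltn_trans _ lt_rp).
Qed.

Lemma frac_lcoefE (F : fieldType) (q p : {poly F}) (N a : nat) :
  p != 0 -> frac_lcoef q p (N%:Z - a%:Z) = ((q * 'X^N) %/ p)`_a.
Proof.
move=> p0; have [le_aN|lt_Na] := leqP a N.
  rewrite subzn //= -[in RHS](subnK le_aN) exprD mulrA.
  by have := coef_divp_mulXn (q * 'X^(N - a)) a 0 p0; rewrite addn0.
have -> : N%:Z - a%:Z = Negz (a - N).-1.
  by rewrite NegzE prednK ?subn_gt0 // -subzn ?opprB // ltnW.
by rewrite /= prednK ?subn_gt0 // -[in RHS](subnKC (ltnW lt_Na)) coef_divp_mulXn.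
Qed.

(* [laurent_frac q p] is q / p: its product with p is q. *)
Lemma laurent_fracP (F : fieldType) (q p : {poly F}) (l : int) : p != 0 ->
  \sum_(i < size p) p`_i * laurent_frac q p (l + i%:Z) = poly_lcoef q l.
Proof.
move=> p0.
pose N := (`|l| + size p)%N; pose Q := (q * 'X^N) %/ p.
have [a Da le_pa] : exists2 a : nat, l = N%:Z - a%:Z & (size p <= a)%N.
  have le_lN : l + (size p)%:Z <= N%:Z by rewrite PoszD lerD2r abszE ler_norm.
  have : 0 <= N%:Z - l.
    by rewrite subr_ge0 (le_trans _ le_lN) // lerDl.
  case Ea: (N%:Z - l) => [a|//] _; exists a; first by rewrite -Ea opprB addrC subrK.
  by rewrite -lez_nat -Ea lerBrDl.
have -> : \sum_(i < size p) p`_i * laurent_frac q p (l + i%:Z) = (p * Q)`_a.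
  rewrite coefM (big_ord_widen_cond a.+1 predT (fun i => p`_i * laurent_frac q p (l + i%:Z))) //=.
    rewrite big_mkcond /=; apply: eq_bigr => i _; case: ltnP => [_|le_pi].
      have le_ia : (i <= a)%N by rewrite -ltnS.
      have -> : l + i%:Z = N%:Z - (a - i)%N%:Z by rewrite Da -subzn // opprB addrA addrAC.
      by congr (_ * _); exact: frac_lcoefE.
    by rewrite nth_default ?mul0r.
  exact: leq_trans le_pa (leqnSn a).
have := congr1 (fun r : {poly F} => r`_a) (divp_eq (q * 'X^N) p).
rewrite /= coefD [X in _ = _ + X]nth_default ?addr0; last first.
  by apply: leq_trans le_pa; apply: ltnW; rewrite ltn_modp.
rewrite [p * Q]mulrC => <-; rewrite coefMXn Da.
have [lt_aN|le_Na] := ltnP a N.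
  by rewrite subzn ?(ltnW lt_aN) //= -(prednK (_ : 0 < N - a)%N) ?subn_gt0.
move: le_Na; rewrite leq_eqVlt => /orP[/eqP ->|lt_Na].
  by rewrite subrr subnn.
have -> : N%:Z - a%:Z = Negz (a - N).-1.
  by rewrite NegzE prednK ?subn_gt0 // -subzn ?opprB // ltnW.
by rewrite /= prednK ?subn_gt0.
Qed.

Section Definitions.
Variables (R : realType) (b : nat).

(* Elements of 'F_b are read as the integers 0, ..., b-1. *)
Definition vm (m : nat) (t : laurent 'F_b) : R :=
  \sum_(1 <= l < m.+1) (t l%:Z : nat)%:R / b%:R ^+ l.

Definition digit (n k : nat) : nat := ((n %/ b ^ k) %% b)%N.

Definition nat_poly (n : nat) : {poly 'F_b} :=
  \poly_(k < (trunc_log b n).+1) (digit n k)%:R.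

Definition tr (m k : nat) : {poly 'F_b} := \poly_(i < m) (digit k i)%:R.

Definition Gstar (m : nat) : pred {poly 'F_b} :=
  [pred g : {poly 'F_b} | (g != 0) && (size g <= m)%N].

(* Meant for x > 0: below it is applied to nonzero k_j, and to values of vm at
   fractions r / p with p irreducible of degree m and r not divisible by p,
   which lie in (0, 1). *)
Definition floor_log (x : R) : int := Num.floor (ln x / ln b%:R).

(* Coordinates {1, ..., d} are represented by 'I_d, and a family of weights
   (eta_u), u a subset of {1, ..., d}, by a function on {set 'I_d}. *)
Section Dimension.
Variables (m d : nat) (eta : {set 'I_d} -> R).

Definition supp (k : 'I_d -> nat) : {set 'I_d} := [set j | k j != 0%N].

Definition r1 (k : 'I_d -> nat) : R :=
  (eta (supp k))^-1 * \prod_(j in supp k) b%:R ^ floor_log (k j)%:R.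

Definition A_p (p : {poly 'F_b}) (g : 'I_d -> {poly 'F_b}) :
    {set {ffun 'I_d -> 'I_(b ^ m)}} :=
  [set k : {ffun 'I_d -> 'I_(b ^ m)} | p %| \sum_(j < d) tr m (k j) * g j].

Definition T_eta (g : 'I_d -> {poly 'F_b}) (p : {poly 'F_b}) : R :=
  \sum_(k in A_p p g | [exists j, (k j : nat) != 0%N])
    (r1 (fun j => k j))^-1.

Definition L_u (u : {set 'I_d}) (x : 'I_d -> R) : R :=
  \prod_(j in u) ((1 - b%:R) * (floor_log (x j))%:~R - b%:R).

(* Depends only on the first s components of g. *)
Definition K_eta (p : {poly 'F_b}) (s : nat) (g : 'I_d -> {poly 'F_b}) : R :=
  \sum_(u : {set 'I_d} | (u != finset.set0) && (u \subset [set j : 'I_d | (j < s)%N]))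
    eta u * \sum_(1 <= n < b ^ m)
      L_u u (fun j => vm m (laurent_frac (nat_poly n * g j) p)).

(* g is a possible output of the component-by-component construction: every
   choice of minimizers is allowed. The index s : 'I_d stands for the
   component s + 1, hence the index s.+1 in K_eta. *)
Definition cbc (p : {poly 'F_b}) (g : 'I_d -> {poly 'F_b}) : Prop :=
  forall s : 'I_d,
    if (s : nat) == 0%N then g s = 1
    else g s \in Gstar m /\
      forall h, h \in Gstar m ->
        K_eta p s.+1 g <= K_eta p s.+1 [eta g with s |-> h].

End Dimension.

End Definitions.

(* Weights indexed by the finite sets of coordinates, where i : nat stands for
   the coordinate i + 1, restricted to the first d coordinates. *)
Definition weights_restr (R : realType) (eta : {fset nat} -> R) (d : nat)
    (u : {set 'I_d}) : R :=
  eta [fset (val i) | i in u]%fset.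

(* The maximum of eta_(v + {j}) / eta_v over the sets v of coordinates that
   precede the coordinate j; the default 0 is harmless for positive weights. *)
Definition max_weight_ratio (R : realType) (eta : {fset nat} -> R) (j : nat) : R :=
  \big[Num.max/0]_(v : {set 'I_j})
    (eta (j |` [fset (val i) | i in v])%fset / eta [fset (val i) | i in v]%fset).

(* Main.v *)
(* Write c = (b - 1) m. Expanding the indicator of [tr_m(k) . g = 0 mod p] in the additive
   characters q |-> z^(coefficient of x^(-1) in q / p), z a b-th root of unity, and summing over k
   factor by factor turns each factor into the factor of L_u (Walsh series of L), whence
     b^m T = sum_u eta_u c^|u| + K_d(g),
   and likewise sum_n L_u(n) >= - c^|u|, since it is a nonnegative number minus c^|u|.
   Averaged over h in G*, the factor of L at n h / p is - c / (b^m - 1), as n h runs through all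
   nonzero residues. Hence a minimizing g_s increases K by at most sum_(s in u) eta_u c^|u|, so
   that K_d(g) <= sum_u eta_u c^|u| and T <= b^(-m) sum_u 2 eta_u c^|u|, which is sharper than
   claimed. For the dimension-free bound, sum_u eta_u c^|u| <= eta_0 prod_j (1 + c rho_j) with
   rho_j the maximal weight ratio at j, and the product is at most exp(c sum_j rho_j). *)
Require Import Defs.
From mathcomp Require Import all_boot all_order all_algebra.
From mathcomp Require Import finmap complex zify ring lra.
From mathcomp Require Import all_classical all_reals all_analysis.
Import Order.TTheory GRing.Theory Num.Theory.
Local Open Scope ring_scope.

Set Implicit Arguments.
Unset Strict Implicit.
Unset Printing Implicit Defensive.

(** * Coefficients of [q / p] at negative powers of x, and the leading one *)

Section LaurentDigits.
Variables (F : fieldType) (p : {poly F}).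

Lemma frac_lcoefD (q r : {poly F}) (k : nat) :
  frac_lcoef (q + r) p k%:Z = frac_lcoef q p k%:Z + frac_lcoef r p k%:Z.
Proof. by rewrite /= mulrDl divpD coefD. Qed.

Lemma frac_lcoefZ (c : F) (q : {poly F}) (k : nat) :
  frac_lcoef (c *: q) p k%:Z = c * frac_lcoef q p k%:Z.
Proof. by rewrite /= -scalerAl divpZl coefZ. Qed.

Lemma frac_lcoef0 (k : nat) : frac_lcoef 0 p k%:Z = 0.
Proof. by rewrite /= mul0r div0p coef0. Qed.

Lemma frac_lcoef_mulXn (q : {poly F}) (i : nat) :
  frac_lcoef (q * 'X^i) p 1 = frac_lcoef q p i.+1%:Z.
Proof. by rewrite /= -mulrA -exprD addn1. Qed.

Lemma frac_lcoef_dvdp (q : {poly F}) (k : nat) :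
  p %| q -> frac_lcoef q p k.+1%:Z = 0.
Proof.
have [->|p0] := eqVneq p 0; first by rewrite dvd0p => /eqP ->; rewrite /= mul0r div0p coef0.
by move=> /dvdpP[c ->]; rewrite /= mulrAC mulpK // coefMXn.
Qed.

Lemma frac_lcoef_modp (q : {poly F}) (k : nat) :
  frac_lcoef (q %% p) p k.+1%:Z = frac_lcoef q p k.+1%:Z.
Proof.
rewrite [in RHS](divp_eq q p) frac_lcoefD (@frac_lcoef_dvdp (_ * p)) ?add0r //.
exact: dvdp_mulIr.
Qed.

Variables (m : nat) (size_p : size p = m.+1).

(* [q %% p] has degree [m - lead_index q], so [x^(- lead_index q)] is the leading term of the
   fractional part of [q / p]. *)
Definition lead_index (q : {poly F}) : nat := (m.+1 - size (q %% p)%R)%N.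

Let p_neq0 : p != 0. Proof. by rewrite -size_poly_eq0 size_p. Qed.

Lemma lead_index_bounds (q : {poly F}) :
  ~~ (p %| q) -> (0 < lead_index q <= m)%N.
Proof.
rewrite /dvdp -size_poly_eq0 /lead_index => q0.
have := ltn_modp q p; rewrite p_neq0 size_p; move: q0; lia.
Qed.

Lemma frac_lcoef_lt_lead (q : {poly F}) (k : nat) :
  (k.+1 < lead_index q)%N -> frac_lcoef q p k.+1%:Z = 0.
Proof.
move=> lt_kl; rewrite -frac_lcoef_modp /= divp_small ?coef0 //.
apply: leq_ltn_trans (size_polyMleq _ _) _.
rewrite size_polyXn size_p; move: lt_kl; rewrite /lead_index; move: (size (q %% p)) => s; lia.
Qed.

(** Multiplying the remainder by ['X^(lead_index q)] brings its degree to exactly $m$, so the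
    quotient by [p] is a nonzero constant. *)
Lemma frac_lcoef_lead (q : {poly F}) :
  ~~ (p %| q) -> frac_lcoef q p (lead_index q)%:Z != 0.
Proof.
move=> ndvd; have /andP[l_gt0 l_lem] := lead_index_bounds ndvd.
rewrite -[lead_index q]prednK // -frac_lcoef_modp prednK //=.
have r0 : q %% p != 0 by [].
have size_num : size (q %% p * 'X^(lead_index q))%R = m.+1.
  rewrite size_Mmonic ?monicXn // size_polyXn.
  move: l_gt0 l_lem; rewrite /lead_index; lia.
have size_quo : size (q %% p * 'X^(lead_index q) %/ p)%R = 1%N.
  by rewrite size_divp // size_num size_p subSnn.
by have := lead_coef_eq0 (q %% p * 'X^(lead_index q) %/ p);
   rewrite lead_coefE size_quo -size_poly_eq0 size_quo => ->.
Qed.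

End LaurentDigits.

(** * Base-b digits of integers and the polynomials built from them *)

Section Digits.
Variables (b : nat) (b_prime : prime b).

Let b_gt0 : (0 < b)%N. Proof. exact: prime_gt0. Qed.

Lemma digit_eq0 (k j : nat) : (k < b ^ j)%N -> digit b k j = 0%N.
Proof. by move=> lt_kb; rewrite /digit divn_small ?mod0n. Qed.

Lemma digit_add_lt (a i k j : nat) :
  (j < a)%N -> digit b (i * b ^ a + k) j = digit b k j.
Proof.
move=> lt_ja; rewrite /digit.
have -> : (i * b ^ a = i * b ^ (a - j.+1) * b * b ^ j)%N.
  by rewrite -[(_ * b * _)%N]mulnA -expnS -mulnA -expnD subnK.
by rewrite divnMDl ?expn_gt0 ?b_gt0 // modnMDl.
Qed.

Lemma digit_add_eq (a i k : nat) :
  (i < b)%N -> (k < b ^ a)%N -> digit b (i * b ^ a + k) a = i.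
Proof.
move=> lt_ib lt_kb; rewrite /digit divnMDl ?expn_gt0 ?b_gt0 //.
by rewrite divn_small // addn0 modn_small.
Qed.

Lemma tr0 (m : nat) : tr b m 0 = 0.
Proof.
by apply/polyP => j; rewrite coef_poly coef0 /digit div0n mod0n if_same.
Qed.

(** Adding a new top digit is the induction step for character sums over [k < b ^ a], which grow by
    one digit at a time. *)
Lemma tr_add (m a i k : nat) : (a < m)%N -> (i < b)%N -> (k < b ^ a)%N ->
  tr b m (i * b ^ a + k) = tr b m k + i%:R *: 'X^a.
Proof.
move=> lt_am lt_ib lt_kb; apply/polyP => j.
rewrite coefD coefZ coefXn !coef_poly.
case: (ltngtP j a) => [lt_ja|lt_aj|->].
- by rewrite mulr0 addr0 digit_add_lt.
- rewrite mulr0 addr0 !digit_eq0 //; first by rewrite (leq_trans lt_kb) ?leq_pexp2l // ltnW.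
  apply: leq_trans (leq_pexp2l b_gt0 lt_aj).
  have : (i.+1 * b ^ a <= b * b ^ a)%N by rewrite leq_mul2r lt_ib orbT.
  by rewrite expnS mulSn; lia.
- by rewrite lt_am digit_add_eq // digit_eq0 // add0r mulr1.
Qed.

Lemma nat_poly_tr (m k : nat) : (k < b ^ m)%N -> nat_poly b k = tr b m k.
Proof.
move=> lt_kb; apply/polyP => j; rewrite !coef_poly.
have b_gt1 := prime_gt1 b_prime.
have [lt_jt|le_tj] := ltnP j; last first.
  case: ifP => // _; rewrite digit_eq0 //.
  exact: leq_trans (trunc_log_ltn k b_gt1) (leq_pexp2l b_gt0 le_tj).
case: ifP => // /negbT; rewrite -leqNgt => le_mj.
by rewrite digit_eq0 // (leq_trans lt_kb) ?leq_pexp2l.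
Qed.

Lemma size_tr (m k : nat) : (size (tr b m k) <= m)%N.
Proof. exact: size_poly. Qed.

Lemma tr_neq0 (m k : nat) : (0 < k < b ^ m)%N -> tr b m k != 0.
Proof.
move=> /andP[k_gt0 lt_kb]; have b_gt1 := prime_gt1 b_prime.
have /andP[le_bk lt_kb'] := trunc_log_bounds b_gt1 k_gt0.
set a := trunc_log b k in le_bk lt_kb'.
have lt_am : (a < m)%N by rewrite -(ltn_exp2l _ _ b_gt1) (leq_ltn_trans le_bk).
apply/eqP => /polyP/(_ a); rewrite coef_poly lt_am coef0 /digit => /(congr1 val).
rewrite [val _]val_Fp_nat // modn_mod modn_small; last by rewrite ltn_divLR ?expn_gt0 ?b_gt0 // -expnS.
by move/eqP; rewrite -leqn0 leqNgt divn_gt0 ?expn_gt0 ?b_gt0 // le_bk.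
Qed.

End Digits.

(** Any root of $1+X+\cdots+X^{b-1}$ works: times $X-1$ this polynomial is $X^b-1$, and at $1$ it
    takes the value $b\ne0$. *)
Lemma exists_root_of_unity (C : closedFieldType) (b : nat) :
  (1 < b)%N -> b%:R != 0 :> C -> exists2 z : C, z ^+ b = 1 & z != 1.
Proof.
move=> b_gt1 b_neq0; pose P : {poly C} := \poly_(i < b) 1.
have size_P : size P = b by rewrite size_poly_eq // oner_neq0.
have : size P != 1 by rewrite size_P; lia.
case/closed_rootP => z; rewrite /root horner_poly => /eqP sum0; exists z.
  apply/eqP; rewrite -subr_eq0 subrX1.
  by under eq_bigr do rewrite -[_ ^+ _]mul1r; rewrite sum0 mulr0.
apply: contra_neq b_neq0 => z1; rewrite -sum0 z1.
by under eq_bigr do rewrite expr1n mulr1; rewrite sumr_const card_ord.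
Qed.

(** On the block of index [a] the value of [trunc_log b] is [a], so weights depending on it come out
    of the inner sums. *)
Lemma big_nat_blocks (V : nmodType) (b m : nat) (f : nat -> V) : (0 < b)%N ->
  \sum_(1 <= k < b ^ m) f k = \sum_(a < m) \sum_(b ^ a <= k < b ^ a.+1) f k.
Proof.
move=> b_gt0; elim: m => [|m IH]; first by rewrite big_ord0 big_geq.
rewrite big_ord_recr /= -IH -big_cat_nat ?expn_gt0 ?b_gt0 //.
by rewrite leq_pexp2l.
Qed.

(* With [l = lead_index p m q] this is the factor [(1 - b) * floor(log_b x) - b] of [L_u] at a
   point [x] of [[b^(-l), b^(1-l))]. *)
Definition walsh_kernel (K : fieldType) (b m : nat) (p q : {poly 'F_b}) : K :=
  (b%:R - 1) * (lead_index p m q)%:R - b%:R.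

(** * Additive characters and Walsh sums, plain and weighted *)

Section WalshSums.
Variables (b : nat) (b_prime : prime b).
Variables (C : fieldType) (z : C) (z_order : z ^+ b = 1) (z_neq1 : z != 1).

Definition chi (t : 'F_b) : C := z ^+ t.

Lemma chi_nat (n : nat) : chi n%:R = z ^+ n.
Proof. by rewrite /chi val_Fp_nat // expr_mod. Qed.

Lemma chiD (s t : 'F_b) : chi (s + t) = chi s * chi t.
Proof. by rewrite -[s]natr_Zp -[t]natr_Zp -natrD !chi_nat exprD. Qed.

Lemma chi0 : chi 0 = 1.
Proof. exact: chi_nat 0. Qed.

(** For $c\ne0$ the terms are the powers of [chi c]. This is not $1$, since otherwise
    $z=\chi(c^{-1}c)=1$, and its $b$-th power is $1$, so the geometric sum vanishes. *)
Lemma chi_sum (c : 'F_b) :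
  \sum_(k < b) chi (k%:R * c) = if c == 0 then b%:R else 0.
Proof.
have [->|c_neq0] := eqVneq.
  by under eq_bigr do rewrite mulr0 chi0; rewrite sumr_const card_ord.
have chiX k : chi (k%:R * c) = chi c ^+ k.
  by rewrite -[c]natr_Zp -natrM !chi_nat -exprM mulnC.
under eq_bigr do rewrite chiX.
apply/eqP; have : chi c - 1 != 0.
  rewrite subr_eq0; apply: contra_neq z_neq1 => chi_c.
  have := chiX (c^-1 : 'F_b); rewrite natr_Zp mulVf // chi_c expr1n.
  by rewrite (chi_nat 1).
move=> /mulfI/inj_eq <-; rewrite mulr0 -subrX1 -chiX.
by rewrite pchar_Fp_0 // mul0r chi0 subrr.
Qed.

Variables (p : {poly 'F_b}) (m : nat) (size_p : size p = m.+1).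

(** For [k < b ^ m], [wal (q * tr b m k)] is the [k]-th Walsh function at [q / p]: the coefficient
    of $x^{-1}$ pairs the digit $\kappa_i$ of [k] with the coefficient of $x^{-(i+1)}$ in $q/p$. *)
Definition wal (q : {poly 'F_b}) : C := chi (frac_lcoef q p 1).

Lemma walD (q r : {poly 'F_b}) : wal (q + r) = wal q * wal r.
Proof. by rewrite /wal (frac_lcoefD _ _ _ 1) chiD. Qed.

Lemma wal0 : wal 0 = 1.
Proof. by rewrite /wal (frac_lcoef0 _ 1) chi0. Qed.

Lemma wal_dvdp (q : {poly 'F_b}) : p %| q -> wal q = 1.
Proof. by move=> dvd; rewrite /wal frac_lcoef_dvdp // chi0. Qed.

(** Splitting off the top digit of [k] turns the sum into a product of one-digit sums, each
    evaluated by [chi_sum]. *)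
Lemma wal_sum_digits (q : {poly 'F_b}) (a : nat) : (a <= m)%N ->
  \sum_(0 <= k < b ^ a) wal (q * tr b m k) =
  \prod_(i < a) (if frac_lcoef q p i.+1%:Z == 0 then b%:R else 0).
Proof.
elim: a => [|a IH] le_am.
  by rewrite expn0 big_nat1 big_ord0 tr0 // mulr0 wal0.
rewrite expnS big_nat_mul big_ord_recr /= -IH ?(ltnW le_am) //.
rewrite -chi_sum mulr_sumr big_mkord; apply: eq_bigr => i _.
rewrite -{1}[(i * b ^ a)%N]add0n mulSn big_addn addnK.
rewrite mulr_suml [LHS]big_nat [RHS]big_nat; apply: eq_bigr => k /andP[_ lt_kb].
rewrite addnC tr_add // mulrDr -scalerAr walD; congr (_ * _).
by rewrite /wal (frac_lcoefZ _ _ _ 1) frac_lcoef_mulXn.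
Qed.

(** All factors equal [b] while the first [a] coefficients vanish; once the leading one is among
    them, the product is zero. *)
Lemma wal_sum (q : {poly 'F_b}) (a : nat) : (a <= m)%N -> ~~ (p %| q) ->
  \sum_(0 <= k < b ^ a) wal (q * tr b m k) =
  if (a < lead_index p m q)%N then b%:R ^+ a else 0.
Proof.
move=> le_am ndvd; have /andP[l_gt0 l_lem] := lead_index_bounds size_p ndvd.
rewrite wal_sum_digits //; case: ltnP => [lt_al|le_la].
  rewrite (eq_bigr (fun=> b%:R)) ?prodr_const ?card_ord // => i _.
  by rewrite (frac_lcoef_lt_lead size_p) ?eqxx // (leq_ltn_trans _ lt_al).
have lt_la : ((lead_index p m q).-1 < a)%N by rewrite prednK.
rewrite (bigD1 (Ordinal lt_la)) //= prednK //.
by rewrite (negbTE (frac_lcoef_lead size_p ndvd)) mul0r.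
Qed.

Lemma wal_sum_dvdp (q : {poly 'F_b}) (a : nat) : p %| q ->
  \sum_(0 <= k < b ^ a) wal (q * tr b m k) = b%:R ^+ a.
Proof.
move=> dvd; under eq_bigr do rewrite wal_dvdp ?dvdp_mulr //.
by rewrite sumr_const_nat subn0 natrX.
Qed.

(** The leading index is at most [m], so with all [m] digits the sum detects divisibility by [p]. *)
Lemma wal_orthogonality (q : {poly 'F_b}) :
  \sum_(0 <= k < b ^ m) wal (q * tr b m k) = if p %| q then b%:R ^+ m else 0.
Proof.
have [dvd|ndvd] := boolP (p %| q); first exact: wal_sum_dvdp.
rewrite wal_sum //; have /andP[_ le_lm] := lead_index_bounds size_p ndvd.
by rewrite ltnNge le_lm.
Qed.

Hypothesis b_neq0 : b%:R != 0 :> C.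

(** The factor that a nonzero component $k$ contributes to $1/r_{1,\boldsymbol{\eta}}$. *)
Definition digit_weight (k : nat) : C := (b%:R ^+ trunc_log b k)^-1.

(** The weight is constant on each block, and a block sum is a difference of two initial sums, which
    are known in closed form. *)
Let weighted_wal_blocks (q : {poly 'F_b}) :
  \sum_(1 <= k < b ^ m) digit_weight k * wal (q * tr b m k) =
  \sum_(a < m) (b%:R ^+ a)^-1 *
    (\sum_(0 <= k < b ^ a.+1) wal (q * tr b m k) -
     \sum_(0 <= k < b ^ a) wal (q * tr b m k)).
Proof.
rewrite big_nat_blocks ?prime_gt0 //; apply: eq_bigr => a _.
have b_gt1 := prime_gt1 b_prime.
rewrite (@big_cat_nat _ _ _ (b ^ a)%N 0 (b ^ a.+1)) ?leq_pexp2l ?prime_gt0 //=.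
rewrite addrAC subrr add0r mulr_sumr [LHS]big_nat [RHS]big_nat; apply: eq_bigr => k k_itv.
by rewrite /digit_weight (trunc_log_eq b_gt1 k_itv).
Qed.

Lemma weighted_wal_sum_dvdp (q : {poly 'F_b}) : p %| q ->
  \sum_(1 <= k < b ^ m) digit_weight k * wal (q * tr b m k) = (b%:R - 1) * m%:R.
Proof.
move=> dvd; rewrite weighted_wal_blocks (eq_bigr (fun=> b%:R - 1)).
  by rewrite sumr_const card_ord mulr_natr.
move=> a _; rewrite !wal_sum_dvdp // exprS.
by field; rewrite expf_neq0.
Qed.

Lemma weighted_wal_sum (q : {poly 'F_b}) : ~~ (p %| q) ->
  \sum_(1 <= k < b ^ m) digit_weight k * wal (q * tr b m k) =
  walsh_kernel C m p q.
Proof.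
move=> ndvd; rewrite /walsh_kernel weighted_wal_blocks.
have /andP[l_gt0 l_lem] := lead_index_bounds size_p ndvd.
set l := lead_index p m q in l_gt0 l_lem *.
(* The contribution of block [a]. The total is $(b-1)(l-1)-1=(b-1)l-b$. *)
pose f a : C := if (a.+1 < l)%N then b%:R - 1 else if (a.+1 == l)%N then -1 else 0.
rewrite (eq_bigr (fun a : 'I_m => f a)); last first.
  move=> a _; have bX_neq0 : b%:R ^+ a != 0 :> C by rewrite expf_neq0.
  rewrite !wal_sum ?(ltnW (ltn_ord a)) // -/l /f.
  case: ltngtP => _.
  - by rewrite exprS; field.
  - by rewrite subrr mulr0.
  - by rewrite sub0r mulrN mulVf.
rewrite -(big_mkord xpredT f) (@big_cat_nat _ _ _ l) //=.
rewrite [X in _ + X]big_nat [X in _ + X]big1 ?addr0; last first.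
  by move=> a /andP[le_la _]; rewrite /f ltnNge (leq_trans le_la) // gtn_eqF.
rewrite -[l]prednK // big_nat_recr //= {2}/f prednK // ltnn eqxx.
rewrite big_nat (eq_bigr (fun=> b%:R - 1)); last first.
  by move=> a /= lt_al; rewrite /f -[l]prednK // ltnS lt_al.
rewrite -big_nat sumr_const_nat subn0 -[in RHS](prednK l_gt0) -mulr_natr.
by rewrite -natr1; ring.
Qed.

End WalshSums.

(** * The logarithm in [L_u] read off from the leading digit *)

Section FloorLog.
Variables (R : realType) (b : nat) (b_gt1 : (1 < b)%N).

Let bR_gt1 : 1 < b%:R :> R. Proof. by rewrite ltr1n. Qed.
Let bR_gt0 : 0 < b%:R :> R. Proof. exact: lt_trans ltr01 bR_gt1. Qed.

Lemma ln_exprz (e : int) : ln (b%:R ^ e) = e%:~R * ln b%:R :> R.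
Proof.
case: e => n; first by rewrite -exprnP lnXn // mulr_natl.
by rewrite NegzE -exprnN lnV ?posrE ?exprn_gt0 // lnXn // mulrNz mulNr mulr_natl.
Qed.

Lemma floor_log_eq (x : R) (e : int) :
  b%:R ^ e <= x < b%:R ^ (e + 1) -> floor_log b x = e.
Proof.
move=> /andP[le_ex lt_xe]; have ln_gt0 : 0 < ln b%:R :> R by exact: ln_gt0.
have x_gt0 : 0 < x by exact: lt_le_trans (exprz_gt0 _ bR_gt0) le_ex.
apply: floor_def; rewrite ler_pdivlMr // ltr_pdivrMr // -!ln_exprz.
by rewrite ler_ln ?ltr_ln ?posrE ?exprz_gt0 // le_ex.
Qed.

Lemma floor_log_nat (k : nat) :
  (0 < k)%N -> floor_log b (k%:R : R) = trunc_log b k.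
Proof.
move=> /(trunc_log_bounds b_gt1) k_itv; apply: floor_log_eq.
by rewrite addrC -intS -!exprnP -!natrX ler_nat ltr_nat.
Qed.

(** The value of digits all equal to $b-1$ in the places $l+1,\dots,n$, by telescoping; it bounds
    [vm] from above in [L_factor]. *)
Lemma digit_tail_sum (l n : nat) : (l <= n)%N ->
  \sum_(l <= k < n) (b%:R - 1) / b%:R ^+ k.+1 = (b%:R ^+ l)^-1 - (b%:R ^+ n)^-1 :> R.
Proof.
move=> le_ln; have := telescope_sumr (fun k => (b%:R ^+ k)^-1 : R) le_ln.
move=> tel; rewrite -[RHS]opprB -tel -sumrN; apply: eq_bigr => k _; rewrite exprS.
have bX_neq0 : b%:R ^+ k != 0 :> R by rewrite expf_neq0 // gt_eqF.
by field; rewrite bX_neq0 gt_eqF.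
Qed.

End FloorLog.

(** With leading place $l$, [vm] is at least $b^{-l}$ by its first nonzero digit, and at most
    $b^{1-l}-b^{-m}$ even if all later digits are $b-1$; so its logarithm has floor $-l$. *)
Lemma L_factor (R : realType) (b m : nat) (p q : {poly 'F_b}) :
  prime b -> size p = m.+1 -> ~~ (p %| q) ->
  (1 - b%:R) * (floor_log b (vm R m (laurent_frac q p)))%:~R - b%:R =
  walsh_kernel R m p q.
Proof.
move=> b_prime size_p ndvd; have b_gt1 := prime_gt1 b_prime.
have /andP[l_gt0 l_lem] := lead_index_bounds size_p ndvd.
have b_gt0 : 0 < b%:R :> R by rewrite ltr0n ltnW.
rewrite /walsh_kernel; set l := lead_index p m q in l_gt0 l_lem *.
suff -> : floor_log b (vm R m (laurent_frac q p)) = - l%:Z.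
  by rewrite mulrNz; ring.
apply: floor_log_eq => //.
have vmE : vm R m (laurent_frac q p) =
    \sum_(l.-1 <= k < m) (frac_lcoef q p k.+1%:Z : nat)%:R / b%:R ^+ k.+1.
  rewrite /vm big_add1 /= (@big_cat_nat _ _ _ l.-1) //=; last by lia.
  rewrite big_nat big1 ?add0r // => k /andP[_ lt_kl].
  rewrite [((_ * _) %/ _)`_0](frac_lcoef_lt_lead size_p) ?mul0r //.
  by rewrite -/l; lia.
have digit_bound (t : 'F_b) : (t : nat)%:R <= b%:R - 1 :> R.
  by rewrite lerBrDr natr1 ler_nat (leq_trans (ltn_ord t)) // Fp_cast.
rewrite vmE; apply/andP; split.
  have lt_lm : (l.-1 < m)%N by rewrite prednK.
  rewrite big_ltn // prednK //.
  rewrite -exprnN -[leLHS]addr0; apply: lerD; last first.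
    by apply: sumr_ge0 => k _; rewrite divr_ge0 ?exprn_ge0 // ltW.
  rewrite -[leLHS]mul1r ler_pM2r ?invr_gt0 ?exprn_gt0 // ler1n lt0n.
  by have := frac_lcoef_lead size_p ndvd; rewrite -val_eqE.
have -> : - l%:Z + 1 = - l.-1%:Z by lia.
rewrite -exprnN; apply: (@le_lt_trans _ _ ((b%:R ^+ l.-1)^-1 - (b%:R ^+ m)^-1)).
  rewrite -digit_tail_sum //; last by lia.
  by apply: ler_sum => k _; rewrite ler_pM2r ?invr_gt0 ?exprn_gt0.
by rewrite ltrBlDr ltrDl invr_gt0 exprn_gt0.
Qed.

(** * Non-divisibility by [p], and duality between sums over [A_p] and sums over [n] *)

Lemma irreducible_ndvdpM (F : fieldType) (p q r : {poly F}) :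
  irreducible_poly p -> ~~ (p %| q) -> ~~ (p %| r) -> ~~ (p %| q * r).
Proof.
by move=> p_irr; rewrite -!(irreducible_poly_coprime _ p_irr) coprimepMr => -> ->.
Qed.

Lemma ndvdp_size (F : fieldType) (p r : {poly F}) :
  r != 0 -> (size r < size p)%N -> ~~ (p %| r).
Proof. by move=> r0 lt_rp; apply: contraL lt_rp => /(dvdp_leq r0); rewrite -leqNgt. Qed.

Lemma ndvdp_tr (b m k : nat) (p : {poly 'F_b}) : prime b -> size p = m.+1 ->
  (0 < k < b ^ m)%N -> ~~ (p %| tr b m k).
Proof.
move=> b_prime size_p k_itv.
by apply: ndvdp_size; rewrite ?tr_neq0 // size_p ltnS size_tr.
Qed.

Section Duality.
Variables (b : nat) (b_prime : prime b).
Variables (p : {poly 'F_b}) (m : nat) (size_p : size p = m.+1) (p_irr : irreducible_poly p).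

Section Characters.
Variables (C : fieldType) (z : C) (z_order : z ^+ b = 1) (z_neq1 : z != 1).
Hypothesis b_neq0 : b%:R != 0 :> C.

Local Notation W := (wal z p).

Let bm_gt0 : (0 < b ^ m)%N. Proof. by rewrite expn_gt0 prime_gt0. Qed.

(** Each term is a weighted Walsh sum. Once the term $k=0$, equal to $(b-1)m$, is added and the sums
    are exchanged, every inner sum vanishes by [wal_orthogonality]. *)
Lemma walsh_kernel_sum_characters (q : {poly 'F_b}) : ~~ (p %| q) ->
  \sum_(1 <= k < b ^ m) walsh_kernel C m p (q * tr b m k) = - ((b%:R - 1) * m%:R).
Proof.
move=> ndvd; pose S r := \sum_(1 <= k < b ^ m) digit_weight b C k * W (r * tr b m k).
have S0 : S (q * tr b m 0) = (b%:R - 1) * m%:R.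
  by rewrite /S weighted_wal_sum_dvdp // tr0 // mulr0 dvdp0.
transitivity (\sum_(1 <= k < b ^ m) S (q * tr b m k)).
  rewrite [LHS]big_nat [RHS]big_nat; apply: eq_bigr => k k_itv.
  rewrite /S weighted_wal_sum //.
  by rewrite irreducible_ndvdpM // ndvdp_tr.
apply/eqP; rewrite -S0 -addr_eq0 addrC -big_ltn // exchange_big_nat /=.
rewrite big_nat big1 // => k k_itv; rewrite -mulr_sumr.
under eq_bigr do rewrite mulrAC.
by rewrite wal_orthogonality // (negbTE (irreducible_ndvdpM _ _ _)) ?mulr0 // ndvdp_tr.
Qed.

Lemma fourier_duality_characters (d : nat) (u : {set 'I_d}) (g : 'I_d -> {poly 'F_b}) :
  (forall j, ~~ (p %| g j)) ->
  b%:R ^+ m * (\sum_(k in A_p m p g | supp (fun j => k j) == u)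
                 \prod_(j in u) digit_weight b C (k j)) =
  ((b%:R - 1) * m%:R) ^+ #|u| +
  \sum_(1 <= n < b ^ m) \prod_(j in u) walsh_kernel C m p (tr b m n * g j).
Proof.
move=> ndvd.
(* The condition that [k] has support [u] is built into the factors: [f] vanishes at a zero entry
   inside [u] and at a nonzero entry outside, so the sum over vectors factors over coordinates. *)
pose f n j (k : 'I_(b ^ m)) : C :=
  if j \in u then (if (k : nat) == 0%N then 0
                   else digit_weight b C k * W (tr b m n * g j * tr b m k))
  else ((k : nat) == 0%N)%:R.
have f_sum n j : \sum_k f n j k =
    if j \in u then \sum_(1 <= k < b ^ m) digit_weight b C k * W (tr b m n * g j * tr b m k)
    else 1.
  rewrite /f; case: ifP => _.
    rewrite -(big_mkord xpredT (fun k => if k == 0%N then 0 else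
      digit_weight b C k * W (tr b m n * g j * tr b m k))).
    rewrite big_ltn //= add0r [LHS]big_nat [RHS]big_nat.
    by apply: eq_bigr => k /andP[k_gt0 _]; rewrite gtn_eqF.
  rewrite (bigD1 (Ordinal bm_gt0)) //= big1 ?addr0 // => k.
  by rewrite -val_eqE /= => /negbTE ->.
have f_prod n (k : {ffun 'I_d -> 'I_(b ^ m)}) : \prod_j f n j (k j) =
    if supp (fun j => k j) == u then
      (\prod_(j in u) digit_weight b C (k j)) * W ((\sum_j tr b m (k j) * g j) * tr b m n)
    else 0.
  rewrite /f; case: eqP => [<-|/eqP neq_u].
    rewrite mulr_suml (big_morph W (walD b_prime z_order p) (wal0 b_prime z_order p)).
    rewrite [X in X * _]big_mkcond -big_split /=; apply: eq_bigr => j _.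
    rewrite inE; case: eqP => [->|_] /=.
      by rewrite tr0 // !mul0r wal0 // mulr1.
    by congr (_ * W _); ring.
  have /exists_inP[j _ neq_j] : [exists j in predT, (j \in supp (fun j => k j)) != (j \in u)].
    apply: contraR neq_u => /exists_inPn eq_u; apply/eqP/setP => j.
    by have /negPn/eqP := eq_u j isT.
  rewrite (bigD1 j) //=; move: neq_j; rewrite inE.
  by case: (j \in u); case: ((k j : nat) == 0%N) => //= _; rewrite mul0r.
(* By orthogonality, $b^m$ times the indicator of [A_p] is a Walsh sum over [n]. *)
transitivity (\sum_(0 <= n < b ^ m) \sum_(k : {ffun 'I_d -> 'I_(b ^ m)}) \prod_j f n j (k j)).
  rewrite exchange_big /= mulr_sumr [LHS]big_mkcond; apply: eq_bigr => k _.
  under [RHS]eq_bigr do rewrite f_prod.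
  rewrite inE; case: (supp _ == u); last by rewrite andbF big1.
  rewrite andbT -mulr_sumr wal_orthogonality // mulrC.
  by case: ifP; rewrite ?mulr0.
under eq_bigr do rewrite -bigA_distr_bigA (eq_bigr _ (fun j _ => f_sum _ j)) -big_mkcond.
(* The term $n=0$ gives $(b-1)m$ at every coordinate of [u]; the other terms give Walsh kernels. *)
rewrite big_ltn //; congr (_ + _).
  rewrite (eq_bigr (fun=> (b%:R - 1) * m%:R)) ?prodr_const // => j _.
  by rewrite weighted_wal_sum_dvdp // tr0 // mul0r dvdp0.
rewrite [LHS]big_nat [RHS]big_nat; apply: eq_bigr => n n_itv; apply: eq_bigr => j _.
by rewrite weighted_wal_sum // irreducible_ndvdpM // ndvdp_tr.
Qed.

End Characters.

Variable (R : realType).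

(** Ring morphisms respect these expressions in [b] and integers, so identities proved with complex
    characters descend to [R] along its injective embedding into [R[i]]. *)
Lemma rmorph_walsh_kernel (K L : fieldType) (f : {rmorphism K -> L}) (q : {poly 'F_b}) :
  f (walsh_kernel K m p q) = walsh_kernel L m p q.
Proof. by rewrite rmorphB rmorphM rmorphB rmorph1 !rmorph_nat. Qed.

Lemma rmorph_digit_weight (K L : fieldType) (f : {rmorphism K -> L}) (k : nat) :
  f (digit_weight b K k) = digit_weight b L k.
Proof. by rewrite fmorphV rmorphXn rmorph_nat. Qed.

Let bC_neq0 : b%:R != 0 :> R[i]%C.
Proof. by rewrite pnatr_eq0 -lt0n prime_gt0. Qed.

Lemma walsh_kernel_sum (q : {poly 'F_b}) : ~~ (p %| q) ->
  \sum_(1 <= k < b ^ m) walsh_kernel R m p (q * tr b m k) = - ((b%:R - 1) * m%:R).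
Proof.
have [z z_order z_neq1] := exists_root_of_unity (prime_gt1 b_prime) bC_neq0.
move=> ndvd; apply: (@complexI R); rewrite rmorphN rmorphM rmorphB rmorph1 !rmorph_nat rmorph_sum.
under eq_bigr do rewrite rmorph_walsh_kernel.
exact: walsh_kernel_sum_characters z_order z_neq1 bC_neq0 _ ndvd.
Qed.

Lemma fourier_duality (d : nat) (u : {set 'I_d}) (g : 'I_d -> {poly 'F_b}) :
  (forall j, ~~ (p %| g j)) ->
  b%:R ^+ m * (\sum_(k in A_p m p g | supp (fun j => k j) == u)
                 \prod_(j in u) digit_weight b R (k j)) =
  ((b%:R - 1) * m%:R) ^+ #|u| +
  \sum_(1 <= n < b ^ m) \prod_(j in u) walsh_kernel R m p (tr b m n * g j).
Proof.
have [z z_order z_neq1] := exists_root_of_unity (prime_gt1 b_prime) bC_neq0.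
move=> ndvd; apply: (@complexI R).
rewrite rmorphD rmorphXn !rmorphM rmorphB rmorph1 rmorphXn !rmorph_nat !rmorph_sum.
under eq_bigr do rewrite rmorph_prod.
under eq_bigr do under eq_bigr do rewrite rmorph_digit_weight.
under [X in _ = _ + X]eq_bigr do rewrite rmorph_prod.
under [X in _ = _ + X]eq_bigr do under eq_bigr do rewrite rmorph_walsh_kernel.
exact: fourier_duality_characters z_order z_neq1 bC_neq0 _ _ _ ndvd.
Qed.

End Duality.

(** Each set [u] of coordinates before [s] is paired with [s |: u]; the inductions over coordinates
    below rest on this. *)
Lemma big_subset_ordS (V : nmodType) (d : nat) (s : 'I_d) (f : {set 'I_d} -> V) :
  \sum_(u : {set 'I_d} | u \subset [set j : 'I_d | (j < s.+1)%N]) f u =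
  \sum_(u : {set 'I_d} | u \subset [set j : 'I_d | (j < s)%N]) (f u + f (s |: u)%SET).
Proof.
rewrite big_split /= (bigID (fun u : {set 'I_d} => s \in u)) /= addrC.
have subS (u : {set 'I_d}) : s \notin u ->
    (u \subset [set j : 'I_d | (j < s.+1)%N]) = (u \subset [set j : 'I_d | (j < s)%N]).
  move=> s_notin; apply/fintype.subsetP/fintype.subsetP => sub j j_in; have := sub j j_in; rewrite !inE.
    rewrite ltnS leq_eqVlt => /orP[/eqP/val_inj eq_js|//].
    by rewrite eq_js (negbTE s_notin) in j_in.
  by move=> /ltnW.
have sub_notin (u : {set 'I_d}) : u \subset [set j : 'I_d | (j < s)%N] -> s \notin u.
  by move=> /fintype.subsetP sub; apply/negP => /sub; rewrite inE ltnn.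
congr (_ + _).
  apply: eq_bigl => u; apply/andP/idP => [[sub s_notin]|sub]; first by rewrite -subS.
  by have s_notin := sub_notin u sub; rewrite subS.
rewrite (reindex_onto (fun u => s |: u)%SET (fun u => u :\ s)%SET) /=; last first.
  by move=> u /andP[_]; exact: finset.setD1K.
apply: eq_bigl => u; rewrite finset.setU11 andbT.
apply/andP/idP => [[sub /eqP eq_u]|sub].
  rewrite -subS; last by rewrite -eq_u finset.setD11.
  by apply: fintype.subset_trans sub; exact: finset.subsetUr.
have s_notin := sub_notin u sub; rewrite finset.setU1K // eqxx; split=> //.
by rewrite finset.subUset finset.sub1set inE ltnSn subS.
Qed.

(** * The quality measure, the quantity [K_eta], and the greedy choice of components *)

Section QualityMeasure.
Variables (R : realType) (b m : nat) (p : {poly 'F_b}).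
Hypotheses (b_prime : prime b) (size_p : size p = m.+1) (p_irr : irreducible_poly p).
Variables (d : nat) (eta : {set 'I_d} -> R) (eta_gt0 : forall u, 0 < eta u).

Let c : R := (b%:R - 1) * m%:R.

Let b_gt1 : (1 < b)%N. Proof. exact: prime_gt1. Qed.

Let c_ge0 : 0 <= c.
Proof. by rewrite mulr_ge0 // subr_ge0 ler1n prime_gt0. Qed.

Definition kernel_sum (u : {set 'I_d}) (g : 'I_d -> {poly 'F_b}) : R :=
  \sum_(1 <= n < b ^ m) \prod_(j in u) walsh_kernel R m p (tr b m n * g j).

(** By duality, adding $c^{|u|}$ gives $b^m$ times a sum of nonnegative weights. *)
Lemma kernel_sum_ge (u : {set 'I_d}) (g : 'I_d -> {poly 'F_b}) :
  (forall j, ~~ (p %| g j)) -> - c ^+ #|u| <= kernel_sum u g.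
Proof.
move=> ndvd; rewrite lerNl -subr_ge0 opprK -(fourier_duality b_prime) //.
by rewrite mulr_ge0 ?exprn_ge0 // sumr_ge0 // => k _; rewrite prodr_ge0 // => j _;
   rewrite invr_ge0 exprn_ge0.
Qed.

(** The empty set is kept with value 0, so that the range has the form that [big_subset_ordS]
    splits. *)
Lemma K_etaE (s : nat) (g : 'I_d -> {poly 'F_b}) : (forall j, ~~ (p %| g j)) ->
  K_eta m eta p s g =
  \sum_(u : {set 'I_d} | u \subset [set j : 'I_d | (j < s)%N])
    (if u == finset.set0 then 0 else eta u * kernel_sum u g).
Proof.
move=> ndvd; rewrite /K_eta [RHS](bigID (pred1 finset.set0)) /=.
rewrite [X in _ = X + _]big1 ?add0r => [|u /andP[_ ->] //].
apply: eq_big => [u|u /andP[/negbTE -> _]]; first by rewrite andbC.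
congr (_ * _); rewrite /kernel_sum [LHS]big_nat [RHS]big_nat; apply: eq_bigr => n n_itv.
apply: eq_bigr => j _; rewrite (@nat_poly_tr _ _ m) //; last by case/andP: n_itv.
by apply: L_factor => //; rewrite irreducible_ndvdpM // ndvdp_tr.
Qed.

Lemma K_etaS (s : 'I_d) (g : 'I_d -> {poly 'F_b}) : (forall j, ~~ (p %| g j)) ->
  K_eta m eta p s.+1 g = K_eta m eta p s g +
  \sum_(u : {set 'I_d} | u \subset [set j : 'I_d | (j < s)%N])
    eta (s |: u)%SET * kernel_sum (s |: u)%SET g.
Proof.
move=> ndvd; rewrite !K_etaE // big_subset_ordS big_split /=; congr (_ + _).
apply: eq_bigr => u _; case: eqP => // /finset.setP/(_ s).
by rewrite finset.setU11 inE.
Qed.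

(** Grouping the vectors [k] by support leaves one application of [fourier_duality] for each
    nonempty [u]. *)
Lemma T_etaE (g : 'I_d -> {poly 'F_b}) : (forall j, ~~ (p %| g j)) ->
  b%:R ^+ m * T_eta m eta g p =
  \sum_(u : {set 'I_d} | u != finset.set0) eta u * c ^+ #|u| + K_eta m eta p d g.
Proof.
move=> ndvd.
have supp_eq0 (k : {ffun 'I_d -> 'I_(b ^ m)}) :
    (supp (fun j => k j) != finset.set0) = [exists j, (k j : nat) != 0%N].
  apply/finset.set0Pn/existsP => -[j]; rewrite ?inE => kj; exists j => //.
  by rewrite inE.
have -> : T_eta m eta g p = \sum_(u : {set 'I_d} | u != finset.set0)
    eta u * \sum_(k in A_p m p g | supp (fun j => k j) == u)
              \prod_(j in u) digit_weight b R (k j).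
  rewrite /T_eta (partition_big (fun k : {ffun 'I_d -> 'I_(b ^ m)} => supp (fun j => k j))
    (fun u => u != finset.set0)) /=; last by move=> k /andP[_]; rewrite supp_eq0.
  apply: eq_bigr => u u_neq0; rewrite mulr_sumr; apply: eq_big => k.
    by rewrite -andbA -supp_eq0; case: (supp _ =P u) => [->|_]; rewrite ?u_neq0 ?andbF.
  move=> /andP[_ /eqP <-]; rewrite /r1 invfM invrK; congr (_ * _).
  rewrite -prodfV; apply: eq_bigr => j; rewrite inE -lt0n => kj_gt0.
  by rewrite floor_log_nat.
have -> : K_eta m eta p d g =
    \sum_(u : {set 'I_d} | u != finset.set0) eta u * kernel_sum u g.
  rewrite K_etaE // [RHS]big_mkcond; apply: eq_big => [u|u _]; last by case: eqP.
  by apply/fintype.subsetP => j _; rewrite inE.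
rewrite -big_split mulr_sumr; apply: eq_bigr => u _ /=.
by rewrite mulrCA (fourier_duality b_prime) // mulrDr.
Qed.

Lemma eq_kernel_sum (u : {set 'I_d}) (g h : 'I_d -> {poly 'F_b}) :
  {in u, g =1 h} -> kernel_sum u g = kernel_sum u h.
Proof.
move=> eq_gh; apply: eq_bigr => n _; apply: eq_bigr => j j_in.
by rewrite eq_gh.
Qed.

(** Only the factor at [s] depends on [k], and by [walsh_kernel_sum] it adds up to $-c$ for each
    [n]. *)
Lemma sum_kernel_sum_tr (s : 'I_d) (u : {set 'I_d}) (g : 'I_d -> {poly 'F_b}) : s \notin u ->
  \sum_(1 <= k < b ^ m) kernel_sum (s |: u)%SET [eta g with s |-> tr b m k] =
  - c * kernel_sum u g.
Proof.
move=> s_notin; rewrite /kernel_sum exchange_big_nat /= mulr_sumr.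
rewrite [LHS]big_nat [RHS]big_nat; apply: eq_bigr => n n_itv.
rewrite -(walsh_kernel_sum b_prime size_p p_irr R (ndvdp_tr b_prime size_p n_itv)) mulr_suml.
apply: eq_bigr => k _; rewrite big_setU1 //= eqxx; congr (_ * _).
apply: eq_bigr => j j_in; case: eqP => // eq_js.
by rewrite eq_js (negbTE s_notin) in j_in.
Qed.

Hypothesis m_gt0 : (0 < m)%N.

Variables (g : 'I_d -> {poly 'F_b}) (g_cbc : cbc m eta p g).

Lemma cbc_ndvdp (j : 'I_d) : ~~ (p %| g j).
Proof.
apply: ndvdp_size; have := g_cbc j; case: eqP => _; rewrite ?inE.
- by move=> ->; rewrite oner_neq0.
- by case=> /andP[].
- by move=> ->; rewrite size_poly1 size_p.
- by case=> /andP[_ le_gm] _; rewrite size_p ltnS.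
Qed.

Lemma cbc_step (s : 'I_d) :
  K_eta m eta p s.+1 g <= K_eta m eta p s g +
  \sum_(u : {set 'I_d} | u \subset [set j : 'I_d | (j < s)%N])
    eta (s |: u)%SET * c ^+ #|(s |: u)%SET|.
Proof.
have s_notin (u : {set 'I_d}) : u \subset [set j : 'I_d | (j < s)%N] -> s \notin u.
  by move=> /fintype.subsetP sub; apply/negP => /sub; rewrite inE ltnn.
set X := \sum_(u | _) _.
have X_ge0 : 0 <= X by rewrite sumr_ge0 // => u _; rewrite mulr_ge0 ?exprn_ge0 // ltW.
(* The first component is set to 1 instead of being minimized. There [u] can only be empty, and the
   kernel sum of the singleton is $-c\le c$. *)
have := g_cbc s; case: eqP => [s0 gs|_ [_ gs_min]].
  rewrite K_etaS ?lerD2l; last exact: cbc_ndvdp.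
  apply: ler_sum => u sub; rewrite ler_pM2l //.
  have -> : u = finset.set0.
    by apply/finset.setP => j; rewrite inE; apply/negP => /(fintype.subsetP sub); rewrite inE s0.
  rewrite finset.setU0 cards1 expr1 /kernel_sum.
  under eq_bigr do rewrite big_set1 gs mulr1 -[tr _ _ _]mul1r.
  rewrite (walsh_kernel_sum b_prime size_p p_irr) ?(le_trans _ c_ge0) ?oppr_le0 //.
  by apply: ndvdp_size; rewrite ?oner_neq0 // size_poly1 size_p.
(* [M] is the number $b^m-1$ of candidates [tr b m k]. Summing the minimality of [g s] over them
   bounds [M] times the increment of [K_eta] by [X], and $M\ge1$ finishes. *)
pose M : R := \sum_(1 <= k < b ^ m) 1.
have M_ge1 : 1 <= M.
  by rewrite /M sumr_const_nat ler1n subn_gt0 -{1}(expn0 b) ltn_exp2l.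
have average : M * K_eta m eta p s.+1 g <= M * K_eta m eta p s g + X.
  rewrite !mulr_suml.
  have le_tr k : (1 <= k < b ^ m)%N -> K_eta m eta p s.+1 g <= K_eta m eta p s g +
     \sum_(u : {set 'I_d} | u \subset [set j : 'I_d | (j < s)%N])
       eta (s |: u)%SET * kernel_sum (s |: u)%SET [eta g with s |-> tr b m k].
    move=> k_itv; apply: le_trans (gs_min (tr b m k) _) _.
      by rewrite inE tr_neq0 // size_tr.
    have ndvd j : ~~ (p %| [eta g with s |-> tr b m k] j).
      by rewrite /=; case: eqP => _; [exact: ndvdp_tr|exact: cbc_ndvdp].
    rewrite K_etaS // lerD2r !K_etaE //; last exact: cbc_ndvdp.
    rewrite le_eqVlt; apply/orP; left; apply/eqP; apply: eq_bigr => u /s_notin sub.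
    case: eqP => // _; congr (_ * _); apply: eq_kernel_sum => j j_in /=.
    by case: eqP => // eq_js; rewrite eq_js (negbTE sub) in j_in.
  apply: (@le_trans _ _ (\sum_(1 <= k < b ^ m) (K_eta m eta p s g +
     \sum_(u : {set 'I_d} | u \subset [set j : 'I_d | (j < s)%N])
       eta (s |: u)%SET * kernel_sum (s |: u)%SET [eta g with s |-> tr b m k]))).
    rewrite [leLHS]big_nat [leRHS]big_nat; apply: ler_sum => k k_itv.
    by rewrite mul1r le_tr.
  rewrite big_split /= lerD //; first by under [leRHS]eq_bigr do rewrite mul1r.
  (* Since the kernel sum of [u] is at least $-c^{|u|}$, multiplying it by $-c$ gives at most
     $c^{|u|+1}$. *)
  rewrite exchange_big /=; apply: ler_sum => u /s_notin sub.
  rewrite -mulr_sumr ler_pM2l // sum_kernel_sum_tr // cardsU1 sub exprS mulNr -mulrN.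
  by rewrite ler_wpM2l // lerNl kernel_sum_ge //; exact: cbc_ndvdp.
rewrite -subr_ge0; nra.
Qed.

Lemma cbc_T_eta_bound :
  T_eta m eta g p <=
  (b%:R ^+ m)^-1 * \sum_(u : {set 'I_d} | u != finset.set0) eta u * (2 * c ^+ #|u|).
Proof.
have bX_gt0 : 0 < b%:R ^+ m :> R by rewrite exprn_gt0 // ltr0n prime_gt0.
rewrite -(ler_pM2l bX_gt0) mulVKf ?gt_eqF // T_etaE; last exact: cbc_ndvdp.
(* The increments in [cbc_step] are exactly the terms of the right-hand sum at the sets containing
   the new coordinate. *)
suff K_le s : (s <= d)%N -> K_eta m eta p s g <=
    \sum_(u : {set 'I_d} | u \subset [set j : 'I_d | (j < s)%N])
      (if u == finset.set0 then 0 else eta u * c ^+ #|u|).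
  have := K_le d (leqnn d).
  rewrite [X in _ <= X -> _](eq_bigl xpredT) => [|u]; last first.
    by apply/fintype.subsetP => j _; rewrite inE.
  rewrite [X in _ <= X -> _](eq_bigr (fun u => if u != finset.set0 then eta u * c ^+ #|u| else 0));
    last by move=> u _; case: eqP.
  rewrite -big_mkcond => K_le_d; apply: le_trans (lerD (lexx _) K_le_d) _.
  by rewrite -big_split /=; apply: ler_sum => u _; rewrite -mulrDr -mulr2n mulr_natl.
elim: s => [|s IH] lt_sd.
  rewrite K_etaE; last exact: cbc_ndvdp.
  apply: ler_sum => u; case: eqP => // u_neq0 /fintype.subsetP sub.
  by case: u_neq0; apply/finset.setP => j; rewrite inE; apply/negP => /sub; rewrite inE.
apply: le_trans (cbc_step (Ordinal lt_sd)) _.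
rewrite (big_subset_ordS (Ordinal lt_sd)) big_split lerD //; first exact: IH (ltnW lt_sd).
apply: ler_sum => u _; case: eqP => // /finset.setP/(_ (Ordinal lt_sd)).
by rewrite finset.setU11 inE.
Qed.

End QualityMeasure.

(** * Weights on finite sets of naturals and the dimension-free bound *)

Lemma weights_restr_setU1 (R : realType) (eta : {fset nat} -> R) (d : nat) (s : 'I_d)
    (u : {set 'I_d}) : (forall v, 0 < eta v) -> u \subset [set j : 'I_d | (j < s)%N] ->
  weights_restr eta (s |: u)%SET <= max_weight_ratio eta s * weights_restr eta u.
Proof.
move=> eta_gt0 /fintype.subsetP sub.
(* [u] is read as a subset of ['I_s], so that its weight ratio is one of the entries in the maximum
   [max_weight_ratio eta s]. *)
pose v : {set 'I_s} := [set j | widen_ord (ltnW (ltn_ord s)) j \in u].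
have fset_v : [fset val i | i in v]%fset = [fset val i | i in u]%fset.
  apply/fsetP => k; apply/imfsetP/imfsetP => /= -[j j_in ->].
    by move: j_in; rewrite inE => j_in; exists (widen_ord (ltnW (ltn_ord s)) j).
  have := sub j j_in; rewrite inE => lt_js; exists (Ordinal lt_js) => //.
  by rewrite inE (_ : widen_ord _ _ = j) //; exact: val_inj.
have fset_U1 : weights_restr eta (s |: u)%SET = eta ((s : nat) |` [fset val i | i in u])%fset.
  congr (eta _); apply/fsetP => k; rewrite in_fset1U; apply/imfsetP/orP => /= [[j + ->]|].
    rewrite !inE => /orP[/eqP ->|j_in]; first by left.
    by right; apply/imfsetP; exists j.
  case=> [/eqP ->|/imfsetP[/= j j_in ->]]; first by exists s; rewrite ?finset.setU11.
  by exists j; rewrite // !inE j_in orbT.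
rewrite -ler_pdivrMr ?fset_U1 /weights_restr -?fset_v //.
exact: (le_bigmax _ (fun v : {set 'I_s} =>
  eta (val s |` [fset val i | i in v])%fset / eta [fset val i | i in v]%fset)).
Qed.

(** Admitting one more coordinate $s$ multiplies the sum by at most $1+c\rho_s$, where $\rho_s$ is
    [max_weight_ratio eta s]. *)
Lemma weights_sum_le (R : realType) (eta : {fset nat} -> R) (c : R) (d : nat) :
  (forall v, 0 < eta v) -> 0 <= c ->
  \sum_(u : {set 'I_d}) weights_restr eta u * c ^+ #|u| <=
  eta fset0 * \prod_(j < d) (1 + c * max_weight_ratio eta j).
Proof.
move=> eta_gt0 c_ge0.
suff sum_le s : (s <= d)%N ->
    \sum_(u : {set 'I_d} | u \subset [set j : 'I_d | (j < s)%N]) weights_restr eta u * c ^+ #|u|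
    <= eta fset0 * \prod_(j < s) (1 + c * max_weight_ratio eta j).
  apply: le_trans (sum_le d (leqnn d)); rewrite le_eqVlt; apply/orP; left; apply/eqP.
  by apply: eq_bigl => u; apply/esym/fintype.subsetP => j _; rewrite inE.
elim: s => [|s IH] lt_sd.
  rewrite big_ord0 mulr1 (big_pred1 finset.set0) => [|u /=].
    rewrite cards0 mulr1 /weights_restr (_ : [fset _ | _ in _]%fset = fset0) //.
    by apply/fsetP => k; rewrite inE; apply/imfsetP => -[/= j]; rewrite inE.
  apply/fintype.subsetP/eqP => [sub|-> j]; last by rewrite inE.
  by apply/finset.setP => j; rewrite inE; apply/negP => /sub; rewrite inE.
rewrite big_ord_recr /= mulrA (big_subset_ordS (Ordinal lt_sd)).
have ratio_ge0 : 0 <= max_weight_ratio eta s by exact: bigmax_ge_id.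
apply: le_trans (ler_wpM2r _ (IH (ltnW lt_sd))); last by rewrite addr_ge0 // mulr_ge0.
rewrite mulr_suml; apply: ler_sum => u sub; rewrite mulrDr mulr1 lerD2l.
have s_notin : Ordinal lt_sd \notin u.
  by apply/negP => /(fintype.subsetP sub); rewrite inE ltnn.
rewrite cardsU1 s_notin exprS.
have := weights_restr_setU1 eta_gt0 sub => /=.
move/(ler_wpM2r (mulr_ge0 c_ge0 (exprn_ge0 #|u| c_ge0))) => /le_trans; apply.
by rewrite le_eqVlt; apply/orP; left; apply/eqP; ring.
Qed.

(** By $1+x\le e^x$ the product is at most the exponential of $c$ times a partial sum, and partial
    sums of a nonnegative series stay below its value. *)
Lemma prod_max_weight_ratio_le (R : realType) (eta : {fset nat} -> R) (c : R) :
  0 <= c -> (\sum_(0 <= j <oo) (max_weight_ratio eta j)%:E < +oo)%E ->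
  exists2 M : R, 0 <= M & forall d, \prod_(j < d) (1 + c * max_weight_ratio eta j) <= M.
Proof.
move=> c_ge0 ratio_fin.
have ratio_ge0 j : 0 <= max_weight_ratio eta j by exact: bigmax_ge_id.
set S := (\sum_(0 <= j <oo) _)%E in ratio_fin.
have S_fin : S \is a fin_num.
  by rewrite ge0_fin_numE // nneseries_ge0 // => j _ _; rewrite lee_fin.
exists (expR (c * fine S)); first exact: expR_ge0.
move=> d; apply: (@le_trans _ _ (\prod_(j < d) expR (c * max_weight_ratio eta j))).
  by apply: ler_prod => j _; rewrite expR_ge1Dx addr_ge0 // mulr_ge0.
rewrite -expR_sum ler_expR -mulr_sumr ler_wpM2l // -lee_fin fineK //.
rewrite -(big_mkord xpredT (max_weight_ratio eta)) -sumEFin.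
by apply: nneseries_lim_ge => j _ _; rewrite lee_fin.
Qed.

Theorem theorem6 (R : realType) (b m : nat) (p : {poly 'F_b})
    (b_prime : prime b) (m_ge4 : (4 <= m)%N)
    (p_irr : irreducible_poly p) (deg_p : size p = m.+1) :
  (forall (d : nat) (eta : {set 'I_d} -> R) (g : 'I_d -> {poly 'F_b}),
     (0 < d)%N ->
     (forall u, 0 < eta u) ->
     cbc m eta p g ->
     T_eta m eta g p <=
       (b%:R ^+ m)^-1 *
       \sum_(u : {set 'I_d} | u != finset.set0)
         eta u *
         (2 * ((b%:R - 1) * m%:R) ^+ #|u| +
          b%:R * m%:R *
          (2 * (b%:R - 1) * m%:R + 2 * b%:R / (b%:R - 1)) ^+ #|u|))
  /\
  (forall eta : {fset nat} -> R,
     (forall u, 0 < eta u) ->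
     (\sum_(0 <= j <oo) (max_weight_ratio eta j)%:E < +oo)%E ->
     exists C : R,
       forall (d : nat) (g : 'I_d -> {poly 'F_b}),
         (0 < d)%N ->
         cbc m (@weights_restr R eta d) p g ->
         T_eta m (@weights_restr R eta d) g p <= C).
Proof.
have m_gt0 : (0 < m)%N by exact: leq_trans m_ge4.
have bB1_ge0 : 0 <= b%:R - 1 :> R by rewrite subr_ge0 ler1n prime_gt0.
have bXV_ge0 : 0 <= (b%:R ^+ m)^-1 :> R by rewrite invr_ge0 exprn_ge0.
split=> [d eta g _ eta_gt0 g_cbc|eta eta_gt0 ratio_fin].
  apply: le_trans (cbc_T_eta_bound b_prime deg_p p_irr eta_gt0 m_gt0 g_cbc) _.
  (* The comparison is termwise: only the nonnegativity of the second summand of the claimed bound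
     remains. *)
  rewrite ler_wpM2l //; apply: ler_sum => u _; rewrite ler_pM2l // lerDl.
  by rewrite mulr_ge0 ?mulr_ge0 // exprn_ge0 // addr_ge0 ?mulr_ge0 // ?mulr_ge0 // invr_ge0.
set c : R := (b%:R - 1) * m%:R; have c_ge0 : 0 <= c by rewrite mulr_ge0.
have [M M_ge0 prod_le] := prod_max_weight_ratio_le c_ge0 ratio_fin.
(* [M] bounds the products over coordinates for every [d]; $b^{-m}$ and the factor 2 come from
   [cbc_T_eta_bound]. *)
exists ((b%:R ^+ m)^-1 * (2 * (eta fset0 * M))) => d g _ g_cbc.
have restr_gt0 (u : {set 'I_d}) : 0 < weights_restr eta u by exact: eta_gt0.
apply: le_trans (cbc_T_eta_bound b_prime deg_p p_irr restr_gt0 m_gt0 g_cbc) _.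
rewrite ler_wpM2l // -/c; under eq_bigr do rewrite mulrCA.
rewrite -mulr_sumr ler_pM2l //.
(* The positive term of the empty set is added to reach the full sum bounded by [weights_sum_le]. *)
apply: (@le_trans _ _ (\sum_(u : {set 'I_d}) weights_restr eta u * c ^+ #|u|)).
  rewrite [leRHS](bigID (fun u => u != finset.set0)) /= lerDl sumr_ge0 // => u _.
  by rewrite mulr_ge0 ?exprn_ge0 // ltW.
apply: le_trans (weights_sum_le d eta_gt0 c_ge0) _.
by rewrite ler_pM2l.
Qed.
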